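(* For every $n\ge1$, the Garside element of the Artin monoid $\mathcal{M}(A_n)$ is $$\Delta(A_n)=x_1(x_2x_1)(x_3x_2x_1)\cdots(x_{n-1}x_{n-2}\cdots x_1)(x_nx_{n-1}\cdots x_1).$$
   Context: $\mathcal{M}(A_n)$ is the monoid with generators $x_1,\dots,x_n$ and relations $x_ix_j=x_jx_i$ for $|i-j|\ge2$ and $x_{i+1}x_ix_{i+1}=x_ix_{i+1}x_i$ for $1\le i\le n-1$ (the positive braid monoid on $n+1$ strands). The notation $\alpha\mid_L\beta$ means $\beta=\alpha\rho$ for some element $\rho$. The Garside element $\Delta$ of this monoid is the unique element such that $x_i\mid_L\Delta$ for all $i$, and whenever $x_i\mid_L\omega$ for all $i$ then $\Delta\mid_L\omega$. *)

(* Defs.v *)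
From HB Require Import structures.
From mathcomp Require Import all_boot.
From mathcomp Require Import boolp.

Set Implicit Arguments.
Unset Strict Implicit.
Unset Printing Implicit Defensive.

Local Open Scope group_scope.
Local Open Scope quotient_scope.

Section PresentedMonoid.
Variables (T : choiceType) (R : seq T -> seq T -> Prop).

Inductive pres_cong : seq T -> seq T -> Prop :=
| pres_cong_rule (p s u v : seq T) :
    R u v -> pres_cong (p ++ u ++ s) (p ++ v ++ s)
| pres_cong_refl (u : seq T) : pres_cong u u
| pres_cong_sym (u v : seq T) : pres_cong u v -> pres_cong v u
| pres_cong_trans (u v w : seq T) :
    pres_cong u v -> pres_cong v w -> pres_cong u w.

Definition pres_eqv : rel (seq T) := fun u v => `[< pres_cong u v >].

Lemma pres_eqv_refl : reflexive pres_eqv.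
Proof. by move=> u; apply/asboolP; apply: pres_cong_refl. Qed.

Lemma pres_eqv_sym : symmetric pres_eqv.
Proof. by move=> u v; apply/asboolP/asboolP; apply: pres_cong_sym. Qed.

Lemma pres_eqv_trans : transitive pres_eqv.
Proof.
move=> v u w /asboolP uv /asboolP vw; apply/asboolP.
exact: pres_cong_trans uv vw.
Qed.

Canonical pres_equiv : equiv_rel (seq T) :=
  EquivRel pres_eqv pres_eqv_refl pres_eqv_sym pres_eqv_trans.

(* The monoid < T | u = v for R u v >, as the quotient of the free monoid. *)
Definition presented_monoid : Type := {eq_quot pres_equiv}.

HB.instance Definition _ := Choice.copy presented_monoid {eq_quot pres_equiv}.

Definition pres_word (u : seq T) : presented_monoid := \pi_({eq_quot pres_equiv}) u.

Lemma pres_wordP (u v : seq T) : pres_word u = pres_word v <-> pres_cong u v.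
Proof.
split; first by move/eqmodP/asboolP.
by move=> uv; apply/eqmodP/asboolP.
Qed.

Definition pres_repr (a : presented_monoid) : seq T :=
  repr (a : {eq_quot pres_equiv}).

Lemma pres_reprK (a : presented_monoid) : pres_word (pres_repr a) = a.
Proof. exact: reprK. Qed.

Lemma pres_cong_cat (u u' v v' : seq T) :
  pres_cong u u' -> pres_cong v v' -> pres_cong (u ++ v) (u' ++ v').
Proof.
have catl p a b : pres_cong a b -> pres_cong (p ++ a) (p ++ b).
  elim=> [q s c d Rcd|c|c d _|c d e _ cd _ de].
  - by rewrite !(catA p); apply: pres_cong_rule.
  - exact: pres_cong_refl.
  - exact: pres_cong_sym.
  - exact: pres_cong_trans cd de.
have catr s a b : pres_cong a b -> pres_cong (a ++ s) (b ++ s).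
  elim=> [p q c d Rcd|c|c d _|c d e _ cd _ de].
  - by rewrite -!catA; apply: pres_cong_rule.
  - exact: pres_cong_refl.
  - exact: pres_cong_sym.
  - exact: pres_cong_trans cd de.
by move=> uu' vv'; apply: pres_cong_trans (catr _ _ _ uu') (catl _ _ _ vv').
Qed.

Definition pres_mul (a b : presented_monoid) : presented_monoid :=
  pres_word (pres_repr a ++ pres_repr b).

Lemma pres_mul_word (u v : seq T) :
  pres_mul (pres_word u) (pres_word v) = pres_word (u ++ v).
Proof. by apply/pres_wordP; apply: pres_cong_cat; apply/pres_wordP/pres_reprK. Qed.

Lemma pres_mulA : associative pres_mul.
Proof.
move=> a b c; rewrite -(pres_reprK a) -(pres_reprK b) -(pres_reprK c).
by rewrite !pres_mul_word catA.
Qed.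

Lemma pres_mul1 : left_id (pres_word [::]) pres_mul.
Proof. by move=> a; rewrite -(pres_reprK a) pres_mul_word. Qed.

Lemma pres_mul1r : right_id (pres_word [::]) pres_mul.
Proof. by move=> a; rewrite -(pres_reprK a) pres_mul_word cats0. Qed.

HB.instance Definition _ :=
  isMonoid.Build presented_monoid pres_mulA pres_mul1 pres_mul1r.

Lemma pres_word_cat (u v : seq T) :
  pres_word (u ++ v) = pres_word u * pres_word v.
Proof. by rewrite -pres_mul_word. Qed.

End PresentedMonoid.

(* Generators are indexed from 0: the letter i : 'I_n stands for x_(i+1). *)
Inductive artinA_rel (n : nat) : seq 'I_n -> seq 'I_n -> Prop :=
| artinA_comm (i j : 'I_n) :
    (i.+2 <= j) || (j.+2 <= i) -> artinA_rel [:: i; j] [:: j; i]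
| artinA_braid (i j : 'I_n) :
    j = i.+1 :> nat -> artinA_rel [:: j; i; j] [:: i; j; i].

Definition artinA (n : nat) : monoidType := presented_monoid (@artinA_rel n).

Definition artin_gen (n : nat) (i : 'I_n) : artinA n :=
  pres_word (@artinA_rel n) [:: i].

Definition ldvd (M : monoidType) (a b : M) : Prop := exists r : M, b = a * r.

Definition garside_property (n : nat) (D : artinA n) : Prop :=
  (forall i : 'I_n, ldvd (artin_gen i) D) /\
  (forall w : artinA n, (forall i : 'I_n, ldvd (artin_gen i) w) -> ldvd D w).

Definition garside_element (n : nat) (D : artinA n) : Prop :=
  unique (@garside_property n) D.

(* Main.v *)
Require Import Defs.
From mathcomp Require Import all_boot all_fingroup.
From mathcomp Require Import zify.

Import GroupScope.

Set Implicit Arguments.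
Unset Strict Implicit.
Unset Printing Implicit Defensive.

(** The relations preserve length, so the monoid carries an additive length
    whose only element of length 0 is 1; left divisibility is therefore
    antisymmetric ([ldvd_anti]), and a Garside element is unique as soon as one
    exists.

    The substance is that the product of the statement is a least common
    multiple of the generators for left divisibility. This rests on Garside's
    lemma: if [x_i s = x_j t], then the common value is a right multiple of
    [x_i] (if i = j), of [x_i x_j] (if i and j are at distance at least 2), or
    of [x_i x_j x_i] (if they are adjacent), with s and t the matching
    cofactors ([lcm_rel]). It contains left cancellation. It is proved by
    induction on length; for a fixed length, it is checked along a chain of
    elementary rewritings, where the only real step is transitivity
    ([lcm_rel_trans]): from [x_i s = x_k w = x_j t], Garside's lemma in smaller
    length, applied to the two factorizations of w, yields a common cofactor of
    s and t.

    Write [c_k = x_(k-1) ... x_0] (indices from 0) and [D_m = c_1 c_2 ... c_m]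
    ([descent k] and [half_twist m]), so that [D_(m+1) = D_m c_(m+1)]. Both
    directions go by induction on m and use that [x_m] commutes with, and can be
    divided out past, every word in letters smaller than m - 1 ([transparent]),
    in particular past [D_(m-1)]. The steps below are for m large enough that
    the indices make sense.
    - Each [x_i] with i < m divides [D_m]: only i = m - 1 is new, and
      [D_m = D_(m-2) c_(m-1) c_m], where [x_(m-1)] divides [c_(m-1) c_m]
      ([gen_dvd_descents]).
    - If every [x_i] with i <= m divides w, then by induction [w = D_m r];
      dividing out [D_(m-1)] shows that [x_m] divides [c_m r], and this forces
      [c_(m+1)] to divide r ([descent_dvd]), that is, [D_(m+1)] to divide w. *)

(** * Length and antisymmetry of divisibility *)

Section Length.
Variable n : nat.
Implicit Types (i j k : 'I_n) (u v w : seq 'I_n) (a b s t : artinA n).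

Local Notation word := (@pres_word _ (@artinA_rel n)).
Local Notation x := (@artin_gen n).

Lemma artin_cong_size u v : pres_cong (@artinA_rel n) u v -> size u = size v.
Proof.
elim=> [p s u' v' []|//|//|u' v' w _ -> _ ->//] i j _;
  by rewrite !size_cat.
Qed.

Definition artin_len a : nat := size (pres_repr a).

Lemma artin_len_word u : artin_len (word u) = size u.
Proof. exact/artin_cong_size/pres_wordP/pres_reprK. Qed.

Lemma artin_lenM a b : artin_len (a * b) = artin_len a + artin_len b.
Proof. by rewrite [LHS]artin_len_word size_cat. Qed.

Lemma artin_len_eq0 a : artin_len a = 0 -> a = 1.
Proof. by move/size0nil=> a0; rewrite -(pres_reprK a) a0. Qed.

Lemma artin_lenS i a : artin_len (x i * a) = (artin_len a).+1.
Proof. by rewrite artin_lenM artin_len_word. Qed.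

Lemma word_cons i u : word (i :: u) = x i * word u.
Proof. by rewrite -[i :: u]cat1s pres_word_cat. Qed.

Lemma ldvd_anti a b : ldvd a b -> ldvd b a -> a = b.
Proof.
move=> [r br] [q aq].
have: artin_len r = 0.
  by move: (congr1 artin_len br) (congr1 artin_len aq); rewrite !artin_lenM; lia.
by move/artin_len_eq0=> r1; rewrite br r1 mulg1.
Qed.

(** * Garside's lemma on common multiples of two generators *)

Definition far i j := (i.+2 <= j) || (j.+2 <= i).
Definition adj i j := (j == i.+1 :> nat) || (i == j.+1 :> nat).

Lemma letterP i j : [\/ i = j, far i j | adj i j].
Proof.
case: (boolP (far i j)) => [fij|nf]; first exact: Or32.
case: (boolP (adj i j)) => [aij|na]; first exact: Or33.
by apply: Or31; apply: val_inj; move: nf na; rewrite /far /adj /=; lia.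
Qed.

Lemma farC i j : far i j = far j i.
Proof. by rewrite /far orbC. Qed.

Lemma adjC i j : adj i j = adj j i.
Proof. by rewrite /adj orbC. Qed.

Lemma word_relM u v s : artinA_rel u v -> word u * s = word v * s.
Proof.
move=> uv; congr (_ * s); apply/pres_wordP.
by have := pres_cong_rule [::] [::] uv; rewrite !cats0.
Qed.

Lemma gen_far i j s : far i j -> x i * (x j * s) = x j * (x i * s).
Proof.
by move/artinA_comm/(word_relM s); rewrite !word_cons -!mulgA !mul1g.
Qed.

Lemma gen_adj i j s :
  adj i j -> x i * (x j * (x i * s)) = x j * (x i * (x j * s)).
Proof.
suff braid k (l : 'I_n) t : l = k.+1 :> nat ->
    x l * (x k * (x l * t)) = x k * (x l * (x k * t)).
  by case/orP=> /eqP; [move/braid-> | move/braid->].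
by move/artinA_braid/(word_relM t); rewrite !word_cons -!mulgA !mul1g.
Qed.

(** The conclusion of Garside's lemma for [x_i s = x_j t]: [x_i s] is a right
    multiple by r of the least common multiple of [x_i] and [x_j]. *)
Inductive lcm_rel i j s t : Prop :=
| LcmSame of i = j & s = t
| LcmFar r of far i j & s = x j * r & t = x i * r
| LcmAdj r of adj i j & s = x j * (x i * r) & t = x i * (x j * r).

Lemma lcm_rel_sym i j s t : lcm_rel i j s t -> lcm_rel j i t s.
Proof.
case=> [-> ->|r fij -> ->|r aij -> ->]; first exact: LcmSame.
- by apply: (@LcmFar _ _ _ _ r); rewrite // farC.
- by apply: (@LcmAdj _ _ _ _ r); rewrite // adjC.
Qed.

(** Garside's lemma as an induction hypothesis; L bounds the cofactor s rather
    than the product, so that s can be factored again. *)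
Definition lcm_below L := forall i j s t,
  artin_len s < L -> x i * s = x j * t -> lcm_rel i j s t.

Section Below.
Variable L : nat.
Hypothesis lcmL : lcm_below L.

Lemma cancel_below i s t : artin_len s < L -> x i * s = x i * t -> s = t.
Proof.
move=> sL /lcmL[] // r; rewrite /far /adj; lia.
Qed.

Lemma far_below i j s t : far i j -> artin_len s < L -> x i * s = x j * t ->
  exists2 r, s = x j * r & t = x i * r.
Proof.
move=> fij sL /lcmL[] //.
- by move=> ij; move: fij; rewrite ij /far; lia.
- by move=> r _ -> ->; exists r.
- by move=> r; move: fij; rewrite /far /adj; lia.
Qed.

Lemma adj_below i j s t : adj i j -> artin_len s < L -> x i * s = x j * t ->
  exists2 r, s = x j * (x i * r) & t = x i * (x j * r).
Proof.
move=> aij sL /lcmL[] //.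
- by move=> ij; move: aij; rewrite ij /adj; lia.
- by move=> r; move: aij; rewrite /far /adj; lia.
- by move=> r _ -> ->; exists r.
Qed.

(** The middle letter k is adjacent to i and far from j. The letters i and j
    are then distinct; if they are adjacent, the three of them span a braid
    monoid on four strands, with i in the middle. *)
Lemma lcm_trans_adj_far i j k a b :
  adj i k -> far k j -> artin_len (x i * (x k * a)) <= L ->
  x i * (x k * a) = x j * b -> lcm_rel i j (x k * (x i * a)) (x k * b).
Proof.
rewrite !artin_lenS => aik fkj aL e.
have kaL : artin_len (x k * a) < L by rewrite artin_lenS.
have aL1 : artin_len a < L by lia.
case: (letterP i j) => [ij|fij|aij].
- by move: aik fkj; rewrite ij /adj /far; lia.
- have [c /(far_below fkj aL1)[d -> ->] ->] := far_below fij kaL e.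
  apply: (@LcmFar _ _ _ _ (x k * (x i * d))) => //.
  + by rewrite (gen_far _ fij) (gen_far _ fkj).
  + by rewrite gen_adj // adjC.
- have [c ka ->] := adj_below aij kaL e.
  have [d aE icE] := far_below fkj aL1 ka.
  have cL : artin_len c < L.
    by move: (congr1 artin_len ka); rewrite !artin_lenS; lia.
  have [f -> dE] := adj_below aik cL icE.
  have aki : adj k i by rewrite adjC.
  rewrite aE dE.
  apply: (@LcmAdj _ _ _ _ (x k * (x i * (x j * f)))) => //.
  + rewrite (gen_adj (x k * f) aij) -(gen_far f fkj) (gen_far _ fkj).
    by rewrite (gen_adj _ aki).
  + rewrite -(gen_far (x i * f) fkj) (gen_adj _ aki) (gen_adj _ aij).
    by rewrite (gen_far _ fkj).
Qed.

(** The three letters i, k, j of a chain [x_i s = x_k w = x_j t] generate a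
    parabolic submonoid; the cases are the Coxeter graphs induced on them. A
    path contains no triangle, so three mutually adjacent letters are excluded. *)
Lemma lcm_rel_trans i j k s t (w : artinA n) : artin_len w <= L ->
  lcm_rel i k s w -> lcm_rel k j w t -> lcm_rel i j s t.
Proof.
move=> wL [-> -> //|a fik -> wa|a aik -> wa].
- case=> [<- <-|b fkj wb ->|b akj wb ->].
  + exact: LcmFar fik _ wa.
  + move: wL; rewrite wa artin_lenS => aL.
    have fki : far k i by rewrite farC.
    have /(lcmL aL)[-> ->|r fij -> ->|r aij -> ->] : x i * a = x j * b
      by rewrite -wa.
    * exact: LcmSame.
    * by apply: (@LcmFar _ _ _ _ (x k * r)); rewrite // gen_far.
    * apply: (@LcmAdj _ _ _ _ (x k * r)) => //.
        by rewrite (gen_far _ fkj) (gen_far _ fki).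
      by rewrite (gen_far _ fki) (gen_far _ fkj).
  + apply: lcm_rel_sym; apply: lcm_trans_adj_far.
    * by rewrite adjC.
    * by rewrite farC.
    * by rewrite -wb.
    * by rewrite -wa -wb.
- case=> [<- <-|b fkj wb ->|b akj wb ->].
  + exact: LcmAdj aik _ wa.
  + apply: lcm_trans_adj_far => //; first by rewrite -wa.
    by rewrite -wa -wb.
  + have e : x i * (x k * a) = x j * (x k * b) by rewrite -wa -wb.
    move: (wL); rewrite wa !artin_lenS => aL.
    have aki : adj k i by rewrite adjC.
    have ajk : adj j k by rewrite adjC.
    have bL : artin_len b = artin_len a.
      by move: (congr1 artin_len e); rewrite !artin_lenS; lia.
    case: (letterP i j) => [ij|fij|aij].
    * move: e; rewrite -ij => /cancel_below/=.
      rewrite artin_lenS => /(_ aL)/cancel_below-> //; first exact: LcmSame.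
      lia.
    (* k is the middle of a path i - k - j. Dividing x_k a = x_j c and
       x_k b = x_i c further expresses c in two ways as a multiple of x_k;
       cancelling x_k reduces to the commuting pair i, j. *)
    * have [|c kac kbc] := far_below fij _ e; first by rewrite artin_lenS.
      have [|d -> cd] := adj_below akj _ kac; first by lia.
      have [|d' -> cd'] := adj_below aki _ kbc; first by lia.
      have cL : artin_len c = artin_len a.
        by move: (congr1 artin_len kac); rewrite !artin_lenS; lia.
      have dL : artin_len a = (artin_len d).+2.
        by rewrite -cL cd !artin_lenS.
      have : x j * d = x i * d'.
        apply: (@cancel_below k); first by rewrite artin_lenS; lia.
        by rewrite -cd -cd'.
      rewrite farC in fij.
      case/(far_below fij); first by lia.
      move=> f -> ->; rewrite farC in fij.
      apply: (@LcmFar _ _ _ _ (x k * (x i * (x j * (x k * f))))) => //.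
        by rewrite (gen_far _ fij) (gen_adj _ aik) (gen_adj _ akj)
          -(gen_far _ fij).
      by rewrite -(gen_far _ fij) (gen_adj _ ajk) (gen_adj _ aki).
    * by move: aik akj aij; rewrite /adj; lia.
Qed.

End Below.

(** [lcm_rel] read on words, so that it can be propagated along the derivation
    of a congruence, whose intermediate words have varying first letters. *)
Definition lcm_heads u v : Prop :=
  match u, v with
  | i :: u', j :: v' => lcm_rel i j (word u') (word v')
  | [::], [::] => True
  | _, _ => False
  end.

Lemma lcm_heads_cong L u v : lcm_below L ->
  pres_cong (@artinA_rel n) u v -> size u <= L.+1 -> lcm_heads u v.
Proof.
move=> lcmL; elim=> {u v} [p s u v uv _|u _|u v uv IH|u v w uv IHu vw IHv].
- case: p => [|i p] /=; last first.
    apply: LcmSame => //; apply/pres_wordP.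
    exact: pres_cong_rule uv.
  (* A rule at the head equates the two ways of completing its first letters to
     their least common multiple. *)
  case: uv => i j ij /=; rewrite !word_cons.
  + exact: LcmFar ij _ _.
  + by apply: LcmAdj => //; rewrite adjC /adj ij eqxx.
- by case: u => //= i u; apply: LcmSame.
- rewrite -(artin_cong_size uv) => /IH.
  by case: u v {uv IH} => [|i u] [|j v] //=; apply: lcm_rel_sym.
- move=> uL; have vL : size v <= L.+1 by rewrite -(artin_cong_size uv).
  move: vL (IHu uL) (IHv vL).
  case: u v w {uv IHu vw IHv uL} => [|i u] [|k v] [|j w] //= vL.
  by apply: (lcm_rel_trans lcmL (w := word v)); rewrite artin_len_word.
Qed.

Lemma lcm_below_all L : lcm_below L.
Proof.
elim: L => // L lcmL i j s t sL e.
rewrite -(pres_reprK s) -(pres_reprK t).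
apply: (@lcm_heads_cong L (i :: _) (j :: _)) => //.
by apply/pres_wordP; rewrite !word_cons !pres_reprK.
Qed.

Lemma gen_cancel i s t : x i * s = x i * t -> s = t.
Proof. exact (cancel_below (@lcm_below_all _) (ltnSn _)). Qed.

Lemma gen_far_eq i j s t : far i j -> x i * s = x j * t ->
  exists2 r, s = x j * r & t = x i * r.
Proof. move=> fij; exact (far_below (@lcm_below_all _) fij (ltnSn _)). Qed.

Lemma gen_adj_eq i j s t : adj i j -> x i * s = x j * t ->
  exists2 r, s = x j * (x i * r) & t = x i * (x j * r).
Proof. move=> aij; exact (adj_below (@lcm_below_all _) aij (ltnSn _)). Qed.

(** What is needed of an element a written with letters far from i. Unlike a
    condition on the letters of a word for a, this one speaks of elements, and
    it passes at once to the iterated products below. *)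
Definition transparent i a :=
  x i * a = a * x i /\ forall s, ldvd (x i) (a * s) -> ldvd (x i) s.

Lemma transparent1 i : transparent i 1.
Proof. by split=> [|s]; rewrite ?mulg1 ?mul1g. Qed.

Lemma transparentM i a b :
  transparent i a -> transparent i b -> transparent i (a * b).
Proof.
move=> [ca da] [cb db]; split; first by rewrite mulgA ca -mulgA cb mulgA.
by move=> s; rewrite -mulgA => /da/db.
Qed.

Lemma transparent_gen i j : far i j -> transparent i (x j).
Proof.
move=> fij; split.
  by have := gen_far 1 fij; rewrite !mulg1.
move=> s [t]; rewrite farC in fij.
by case/(gen_far_eq fij) => r -> _; exists r.
Qed.

End Length.

(** * The half twist *)

Section Staircase.
Variable n : nat.

Local Notation x k := (@artin_gen n.+1 (inord k)).

Definition descent k : artinA n.+1 := \prod_(j <- rev (iota 0 k)) x j.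
Definition half_twist m : artinA n.+1 := \prod_(k < m) descent k.+1.

Lemma descent0 : descent 0 = 1.
Proof. by rewrite /descent big_nil. Qed.

Lemma descentS k : descent k.+1 = x k * descent k.
Proof.
have iotaSr : iota 0 k.+1 = rcons (iota 0 k) k.
  by rewrite -cats1 -(iotaD 0 k 1) addn1.
by rewrite /descent iotaSr rev_rcons big_cons.
Qed.

Lemma half_twistS m : half_twist m.+1 = half_twist m * descent m.+1.
Proof. by rewrite /half_twist big_ord_recr. Qed.

Lemma adj_inord k : k < n -> adj (inord k.+1 : 'I_n.+1) (inord k).
Proof. by move=> kn; rewrite /adj !inordK ?eqxx ?orbT //; lia. Qed.

Lemma transparent_descent m k :
  k < m -> m <= n -> transparent (inord m) (descent k).
Proof.
move=> km mn; rewrite /descent big_seq.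
apply: (big_ind (transparent (inord m))).
- exact: transparent1.
- exact: transparentM.
- move=> j; rewrite mem_rev mem_iota => jk; apply: transparent_gen.
  by rewrite /far !inordK; lia.
Qed.

Lemma transparent_half_twist m k :
  k < m -> m <= n -> transparent (inord m) (half_twist k).
Proof.
move=> km mn; apply: (big_ind (transparent (inord m))).
- exact: transparent1.
- exact: transparentM.
- by move=> [j jk] _; apply: transparent_descent => //=; lia.
Qed.

(** With [c_k] for [descent k], [x_(k+1)] passes [c_k], so
    [c_(k+1) c_(k+2) = x_k x_(k+1) (c_k c_(k+1))]; the induction hypothesis
    puts [x_k] in front of the last factor, and the braid relation turns
    [x_k x_(k+1) x_k] into [x_(k+1) x_k x_(k+1)]. *)
Lemma gen_dvd_descents k :
  k <= n -> ldvd (x k) (descent k * descent k.+1).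
Proof.
elim: k => [|k IH] kn; first by exists 1; rewrite descentS descent0 mul1g.
have [t ckE] := IH (ltnW kn).
have [comm_ck _] := transparent_descent (ltnSn k) kn.
exists (x k * (x k.+1 * t)).
rewrite (descentS k.+1) {1}(descentS k) (gen_adj _ (adj_inord kn)).
by rewrite -ckE -!mulgA (mulgA (descent k)) -comm_ck -mulgA.
Qed.

Lemma gen_dvd_half_twist m i :
  i < m -> m <= n.+1 -> ldvd (x i) (half_twist m).
Proof.
elim: m => // m IH; rewrite ltnS leq_eqVlt => /orP[/eqP->|im] mn; last first.
  by have [r hE] := IH im (ltnW mn); exists (r * descent m.+1);
     rewrite half_twistS hE mulgA.
case: m mn {IH} => [|m] mn.
  by exists 1; rewrite half_twistS /half_twist big_ord0 descentS descent0 !mul1g.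
rewrite ltnS in mn; have [t dE] := gen_dvd_descents mn.
have [comm_h _] := transparent_half_twist (ltnSn m) mn.
exists (half_twist m * t).
by rewrite !half_twistS -mulgA dE !mulgA comm_h.
Qed.

(** Garside's lemma for the adjacent letters of
    [x_k (c_k r) = x_(k+1) q] gives [c_k r = x_(k+1) x_k t]. As [x_(k+1)] is far
    from the letters of [c_k], it divides r, say [r = x_(k+1) r']; cancelling
    it leaves [c_k r' = x_k t], which is the hypothesis one step lower. *)
Lemma descent_dvd k r :
  k <= n -> ldvd (x k) (descent k * r) -> ldvd (descent k.+1) r.
Proof.
elim: k r => [|k IH] r kn; first by rewrite descentS !descent0 mul1g mulg1.
have [comm_ck dvd_ck] := transparent_descent (ltnSn k) kn.
rewrite descentS -mulgA => -[q].
have akS : adj (inord k) (inord k.+1 : 'I_n.+1) by rewrite adjC adj_inord.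
case/(gen_adj_eq akS) => t ckr _.
have [|r' rE] := dvd_ck r; first by exists (x k * t).
have [|r'' r'E] := IH r' (ltnW kn).
  exists t; apply: (@gen_cancel _ (inord k.+1)).
  by rewrite -ckr rE mulgA comm_ck mulgA.
by exists r''; rewrite rE r'E [descent k.+2]descentS mulgA.
Qed.

Lemma half_twist_dvd m w : m <= n.+1 ->
  (forall i, i < m -> ldvd (x i) w) -> ldvd (half_twist m) w.
Proof.
elim: m => [|m IH] mn dvd_w.
  by exists w; rewrite /half_twist big_ord0 mul1g.
have [|r wE] := IH (ltnW mn); first by move=> i im; apply: dvd_w; apply: ltnW.
have [q rE] : ldvd (descent m.+1) r.
  apply: descent_dvd => //; have := dvd_w m (ltnSn m); rewrite wE.
  case: m mn {IH dvd_w wE} => [|m] mn.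
    by rewrite /half_twist big_ord0 descent0.
  rewrite ltnS in mn; rewrite half_twistS -mulgA.
  by have [_] := transparent_half_twist (ltnSn m) mn; apply.
by exists q; rewrite wE rE half_twistS mulgA.
Qed.

Lemma half_twistE :
  half_twist n.+1 =
  \prod_(i < n.+1) \prod_(j <- rev (enum 'I_n.+1) | j <= i) artin_gen j.
Proof.
apply: eq_bigr => i _.
rewrite (eq_bigr (fun j : 'I_n.+1 => x (val j))); last first.
  by move=> j _; rewrite inord_val.
rewrite -(big_map val (fun j => j <= i) (fun j => x j)) map_rev val_enum_ord.
by rewrite -big_filter filter_rev (@filter_iota_leq n.+1 0 i).
Qed.

End Staircase.

(* [enum 'I_n] is increasing, so the inner product runs over the indices
   j <= i in decreasing order. *)
Theorem corollary1 (n : nat) (hn : 0 < n) :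
  garside_element
    (\prod_(i < n) \prod_(j <- rev (enum 'I_n) | j <= i) artin_gen j : artinA n).
Proof.
case: n hn => // n _; rewrite -half_twistE.
have garside_h : garside_property (half_twist n n.+1).
  split=> [i|w dvd_w].
    by rewrite -[i in artin_gen i]inord_val; apply: gen_dvd_half_twist.
  by apply: half_twist_dvd => // i _; apply: dvd_w.
split=> // D [dvd_D D_min]; apply: ldvd_anti; last exact: D_min garside_h.1.
exact: garside_h.2.
Qed.
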